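(* If $\mathcal{G}$ is a graph model which is freely generated by a finite partial pair, then its equational theory $\mathrm{Th}(\mathcal{G})$ is not recursively enumerable.
   Context: For a set $A$, $A^*$ is the set of finite subsets of $A$. A *partial pair* is $\mathcal{A}=(A,j_{\mathcal{A}})$ with $A$ a non-empty set and $j_{\mathcal{A}}:A^*\times A\to A$ a partial (possibly total) injection; it is *finite* if $A$ is finite. A *total pair* $(G,i)$ has $G$ infinite and $i:G^*\times G\to G$ a total injection. The *graph model* with web $(G,i)$ is the $\lambda$-model carried by the powerset $\mathcal{P}(G)$ ordered by inclusion, in which for $\rho:\mathrm{Var}\to\mathcal{P}(G)$ untyped $\lambda$-terms are interpreted by $|x|_\rho=\rho(x)$, $|MN|_\rho=\{\alpha\in G:\exists a\subseteq|N|_\rho\text{ finite},\ i(a,\alpha)\in|M|_\rho\}$, $|\lambda x.M|_\rho=\{i(a,\alpha):a\in G^*,\ \alpha\in|M|_{\rho[x:=a]}\}$. Its equational theory is $\mathrm{Th}(\mathcal{G})=\{(M,N):|M|_\rho=|N|_\rho\ \forall\rho\}$. The *free completion* of a partial pair $\mathcal{A}$ (where, up to isomorphism, no element of $A$ is an ordered pair) is the total pair $\overline{\mathcal{A}}=(\overline{A},i_{\overline{\mathcal A}})$ with $\overline{A}=\bigcup_n A_n$, $A_0=A$, $A_{n+1}=A\cup((A_n^*\times A_n)\setminus\mathrm{dom}(j_{\mathcal{A}}))$, and $i_{\overline{\mathcal A}}(a,\alpha)=j_{\mathcal{A}}(a,\alpha)$ if $(a,\alpha)\in\mathrm{dom}(j_{\mathcal{A}})$,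 $i_{\overline{\mathcal A}}(a,\alpha)=(a,\alpha)$ otherwise. A graph model is *freely generated* by $\mathcal{A}$ if its web is $\overline{\mathcal{A}}$. A set of pairs of $\lambda$-terms is recursively enumerable if its set of codes under a fixed effective Gödel numbering is r.e. *)

(* Defs.v *)
From HB Require Import structures.
From mathcomp Require Import all_boot finmap.
From mathcomp Require Import boolp classical_sets functions cardinality.

Set Implicit Arguments.
Unset Strict Implicit.
Unset Printing Implicit Defensive.

Local Open Scope classical_set_scope.

(* Finite subsets of A are rendered by {fset A}, which asks for a choiceType;
   under the axiom of choice every type carries such a structure. *)
Record partial_pair := PartialPair {
  pp_carrier :> choiceType;
  pp_fun : {fset pp_carrier} * pp_carrier -> option pp_carrier;
  pp_nonempty : [set: pp_carrier] !=set0;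
  pp_inj : forall p q x, pp_fun p = Some x -> pp_fun q = Some x -> p = q
}.

Record total_pair := TotalPair {
  tp_carrier :> choiceType;
  tp_fun : {fset tp_carrier} * tp_carrier -> tp_carrier;
  tp_infinite : infinite_set [set: tp_carrier];
  tp_inj : injective tp_fun
}.

Definition finite_partial_pair (A : partial_pair) : Prop :=
  finite_set [set: A].

Definition isomorphic (G H : total_pair) : Prop :=
  exists f : G -> H, bijective f /\
    forall (a : {fset G}) (alpha : G),
      f (tp_fun (a, alpha)) = tp_fun ((f @` a)%fset, f alpha).

Section FreeCompletion.
Variable A : partial_pair.

(* The free completion is carved out of a universe of trees in which the
   elements of A sit as leaves, hence are never ordered pairs, and in which the
   ordered pair of a finite set a and an element alpha is the node with children
   alpha and the elements of a.  The enumeration of an {fset _} is determined by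
   its elements, so this encoding is injective; see [opair_inj]. *)
Definition universe := GenTree.tree A.

Definition atom (x : A) : universe := GenTree.Leaf x.

Definition opair (a : {fset universe}) (alpha : universe) : universe :=
  GenTree.Node 0 (alpha :: enum_fset a).

Lemma atom_inj : injective atom.
Proof. by move=> x y []. Qed.

Lemma opair_inj a alpha b beta :
  opair a alpha = opair b beta -> a = b /\ alpha = beta.
Proof.
case=> -> e; split=> //; apply/fsetP => x.
by change (x \in enum_fset a = (x \in enum_fset b)); rewrite e.
Qed.

(* The graph of the partial injection of A, transported along [atom]. *)
Definition pp_graph (a : {fset universe}) (alpha u : universe) : Prop :=
  exists b beta x, [/\ pp_fun (b, beta) = Some x,
    a = (atom @` b)%fset, alpha = atom beta & u = atom x].

Definition pp_dom (a : {fset universe}) (alpha : universe) : Prop :=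
  exists u, pp_graph a alpha u.

Fixpoint stage (n : nat) : set universe :=
  if n is m.+1 then
    range atom `|`
    [set u | exists a alpha, [/\ [set` a] `<=` stage m, stage m alpha,
       ~ pp_dom a alpha & u = opair a alpha]]
  else range atom.

Definition completion_web : set universe := \bigcup_n stage n.

(* The value of the partial injection at (a, alpha) when it is defined there,
   and the pair (a, alpha) itself otherwise. *)
Definition completion_op (a : {fset universe}) (alpha : universe) : universe :=
  xget (opair a alpha) [set u | pp_graph a alpha u].

Lemma pp_graph_inj a alpha b beta u :
  pp_graph a alpha u -> pp_graph b beta u -> a = b /\ alpha = beta.
Proof.
move=> [a' [al' [x [Hx -> -> ->]]]] [b' [be' [y [Hy -> -> /atom_inj exy]]]].
by rewrite -exy in Hy; case: (pp_inj Hx Hy) => -> ->.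
Qed.

Lemma stageS n : stage n `<=` stage n.+1.
Proof.
elim: n => [|n IHn] u; first by move=> ?; left.
case=> [?|[a [al [sa sal nd ->]]]]; first by left.
right; exists a, al; split=> //; last exact: IHn.
by move=> x /sa; apply: IHn.
Qed.

Lemma stage_le m n : m <= n -> stage m `<=` stage n.
Proof.
move=> /subnK <-; elim: (n - m) => [//|k IHk] x /IHk.
by rewrite addSn; apply: stageS.
Qed.

Lemma stage_fset (a : {fset universe}) :
  [set` a] `<=` completion_web -> exists n, [set` a] `<=` stage n.
Proof.
move=> sa.
suff [n Hn] : exists n, forall x, x \in enum_fset a -> stage n x by exists n.
have {}sa : forall x, x \in enum_fset a -> completion_web x by exact: sa.
elim: (enum_fset a) sa => [|y s IHs] sa; first by exists 0.
have [n Hn] : exists n, forall x, x \in s -> stage n x.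
  by apply: IHs => x xs; apply: sa; rewrite inE xs orbT.
have [m _ Hm] := sa y (mem_head _ _).
exists (maxn m n) => x; rewrite inE => /orP[/eqP ->|/Hn].
  exact: (stage_le (leq_maxl m n)).
exact: (stage_le (leq_maxr m n)).
Qed.

Lemma completion_op_web a alpha :
  [set` a] `<=` completion_web -> completion_web alpha ->
  completion_web (completion_op a alpha).
Proof.
move=> /stage_fset[n sa] [m _ sal]; rewrite /completion_op.
case: xgetP => [u _ [b [be [x [_ _ _ ->]]]]|nd].
  by exists 0 => //; exists x.
exists (maxn m n).+1 => //; right; exists a, alpha; split=> //.
- by move=> x /sa; apply: stage_le; apply: leq_maxr.
- exact: (stage_le (leq_maxl m n)).
- by case=> u /nd.
Qed.

Lemma completion_op_inj a alpha b beta :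
  completion_op a alpha = completion_op b beta -> a = b /\ alpha = beta.
Proof.
rewrite /completion_op.
case: xgetP => [u _ Hu|_]; case: xgetP => [v _ Hv|_] e.
- by rewrite e in Hu; exact: pp_graph_inj Hu Hv.
- by case: Hu e => [? [? [x [_ _ _ ->]]]].
- by case: Hv e => [? [? [x [_ _ _ ->]]]].
- exact: opair_inj e.
Qed.

Lemma completion_fun_subproof (p : {fset completion_web} * completion_web) :
  completion_op (val @` p.1)%fset (val p.2) \in completion_web.
Proof.
apply/mem_set/completion_op_web; last exact: set_mem (valP p.2).
by move=> x /= /imfsetP[y _ ->]; exact: set_mem (valP y).
Qed.

Definition completion_fun (p : {fset completion_web} * completion_web) :
    completion_web :=
  exist _ (completion_op (val @` p.1)%fset (val p.2))
    (completion_fun_subproof p).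

Lemma completion_fun_inj : injective completion_fun.
Proof.
move=> [a al] [b be] /(congr1 val) /= /completion_op_inj[e /val_inj ->].
congr (_, _); apply/fsetP => x.
have := congr1 (fun c : {fset universe} => val x \in c) e.
by rewrite /= !mem_imfset //; exact: val_inj.
Qed.

Lemma completion_infinite : infinite_set [set: completion_web].
Proof.
move=> fin.
have [x0 _] := pp_nonempty A.
have x0P : atom x0 \in completion_web.
  by apply: mem_set; exists 0 => //; exists x0.
pose y0 : completion_web := exist _ (atom x0) x0P.
pose f (a : {fset completion_web}) := completion_fun (a, y0).
have finj : injective f by move=> a b /completion_fun_inj[].
pose D : set completion_web := [set y | exists2 a, y = f a & y \notin a].
have finD : finite_set D by exact: sub_finite_set fin.
have DE y : (y \in fset_set D) <-> D y.
  by rewrite in_fset_set //; split=> [/set_mem|/mem_set].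
have [fD|fD] := boolP (f (fset_set D) \in fset_set D).
  by have /DE[a /finj <-] := fD; rewrite fD.
by move/negP: (fD); apply; apply/DE; exists (fset_set D).
Qed.

Definition free_completion : total_pair :=
  TotalPair completion_infinite completion_fun_inj.

End FreeCompletion.

(* Having web the free completion of A is understood up to isomorphism, since
   the free completion itself is only defined once A has been renamed so as to
   contain no ordered pair. *)
Definition freely_generated (G : total_pair) (A : partial_pair) : Prop :=
  isomorphic G (free_completion A).

Inductive term : Type :=
  | Var of nat
  | App of term & term
  | Lam of nat & term.

Definition update (T : Type) (rho : nat -> T) (x : nat) (v : T) : nat -> T :=
  fun y => if y == x then v else rho y.

Fixpoint interp (G : total_pair) (M : term) (rho : nat -> set G) : set G :=
  match M with
  | Var x => rho x
  | App M N => [set alpha | exists a : {fset G},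
      [set` a] `<=` interp N rho /\ interp M rho (tp_fun (a, alpha))]
  | Lam x M => [set gamma | exists (a : {fset G}) (alpha : G),
      interp M (update rho x [set` a]) alpha /\ gamma = tp_fun (a, alpha)]
  end.

Definition Th (G : total_pair) : set (term * term) :=
  [set p | forall rho : nat -> set G, interp p.1 rho = interp p.2 rho].

(* Syntax of the partial recursive functions of arity n. *)
Inductive recfun : nat -> Type :=
  | Rzero n : recfun n
  | Rsucc : recfun 1
  | Rproj n (i : 'I_n) : recfun n
  | Rcomp m n (f : recfun m) (g : 'I_m -> recfun n) : recfun n
  | Rprim n (f : recfun n) (g : recfun n.+2) : recfun n.+1
  | Rmin n (f : recfun n.+1) : recfun n.

(* [computes f v y]: the partial function denoted by f is defined at v, with
   value y.  Recursion and minimisation act on the first argument; the step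
   function of a recursion receives the counter, then the previous value. *)
Fixpoint computes n (f : recfun n) : n.-tuple nat -> nat -> Prop :=
  match f in recfun n return n.-tuple nat -> nat -> Prop with
  | Rzero _ => fun _ y => y = 0
  | Rsucc => fun v y => y = (thead v).+1
  | Rproj _ i => fun v y => y = tnth v i
  | Rcomp m _ f g => fun v y => exists w : m.-tuple nat,
      (forall i, computes (g i) v (tnth w i)) /\ computes f w y
  | Rprim _ f g => fun v =>
      (fix loop (k : nat) (y : nat) : Prop :=
         if k is k'.+1 then
           exists z, loop k' z /\
             computes g [tuple of k' :: z :: behead_tuple v] y
         else computes f (behead_tuple v) y) (thead v)
  | Rmin _ f => fun v y => computes f [tuple of y :: v] 0 /\
      forall k, k < y -> exists z, computes f [tuple of k :: v] z.+1
  end.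

Definition rec_enumerable (S : set nat) : Prop :=
  exists f : recfun 1, forall n, S n <-> exists y, computes f [tuple n] y.

(* Cantor's pairing function. *)
Definition cantor (m n : nat) : nat := 'C((m + n).+1, 2) + n.

Fixpoint code (M : term) : nat :=
  match M with
  | Var x => 3 * x
  | App M N => 3 * cantor (code M) (code N) + 1
  | Lam x M => 3 * cantor x (code M) + 2
  end.

Definition code_pair (p : term * term) : nat := cantor (code p.1) (code p.2).

Definition rec_enumerable_pairs (E : set (term * term)) : Prop :=
  rec_enumerable [set code_pair p | p in E].

(* Main.v *)
From mathcomp Require Import all_boot finmap zify.
From mathcomp Require Import boolp classical_sets cardinality.
Require Import Defs.

Set Implicit Arguments.
Unset Strict Implicit.
Unset Printing Implicit Defensive.

Local Open Scope classical_set_scope.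

(** Call an element of the free completion an atom if it comes from A, and call
    a closed term small if all elements of its interpretation are atoms.  There
    are finitely many atoms, so there is a finite list of closed small terms
    such that every closed small term has the same interpretation as one of
    them.  If Th(G) were recursively enumerable, a program could therefore
    recognise the small closed terms: it would wait for an equation between the
    given term and a member of the list.  Diagonalisation gives a closed term Q
    that runs this search on its own code, turns into the identity if the
    search succeeds and diverges otherwise ([diagonal]).

    If the search succeeds, Q is small by the correctness of the enumeration;
    but Q then denotes the identity, which contains the infinitely many
    elements i({alpha}, alpha) ([interp_id_infinite]), so Q is not small.
    If the search fails, Q diverges; and a diverging closed term is small
    ([interp_not_atom_halts]), so Q has the interpretation of some member of
    the list and the search should have succeeded.

    That diverging terms are small is where freeness is used.  An element of
    the completion that is not an atom is a pair (a, alpha) built from strictly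
    simpler elements, hence can be read as a type a -> alpha, while an atom can
    be read as a type that promises nothing.  A realizability argument by
    recursion on types shows that a term with an arrow type has a weak head
    normal form.  The equations that the partial pair puts on its atoms do
    no harm, because they relate types without content.

    Evaluation is modelled by Krivine's abstract machine, which needs neither
    substitution nor renaming of bound variables.  The interpretation in the
    model is invariant under its transitions ([steps_interp]), so it
    suffices to program Q for the machine: numbers are Scott numerals, and
    a partial recursive function is replaced by a total approximation that
    receives a bound on its unbounded searches ([eval_within]).  Only the
    outermost search of Q is unbounded, which makes it possible to run the
    searches for all members of the list in parallel. *)

(** * Graph models *)

Lemma update_same (T : Type) (rho : nat -> T) x v : update rho x v x = v.
Proof. by rewrite /update eqxx. Qed.

Lemma update_other (T : Type) (rho : nat -> T) x v y :
  y != x -> update rho x v y = rho y.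
Proof. by rewrite /update => /negbTE ->. Qed.

Lemma update_update (T : Type) (rho : nat -> T) x v v' :
  update (update rho x v) x v' = update rho x v'.
Proof. by apply: funext => y; rewrite /update; case: eqP. Qed.

Lemma update_swap (T : Type) (rho : nat -> T) x y v v' : x != y ->
  update (update rho x v) y v' = update (update rho y v') x v.
Proof.
move=> /eqP xy; apply: funext => z; rewrite /update.
by case: eqP => [->|//]; case: eqP => // /esym.
Qed.

Lemma update_map (S T : Type) (h : S -> T) (rho : nat -> S) x v :
  h \o update rho x v = update (h \o rho) x (h v).
Proof. by apply: funext => y; rewrite /= /update; case: eqP. Qed.

Section GraphModel.
Variable G : total_pair.
Implicit Types (rho : nat -> set G) (M N : term) (a b : {fset G}) (Y : set G).

Definition apply_set (X Y : set G) : set G :=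
  [set alpha | exists a : {fset G}, [set` a] `<=` Y /\ X (tp_fun (a, alpha))].

Lemma interp_mono M rho rho' : (forall x, rho x `<=` rho' x) ->
  interp M rho `<=` interp M rho'.
Proof.
elim: M rho rho' => [x|M IHM N IHN|x M IHM] rho rho' le alpha /=.
- by move=> /le.
- move=> [a [aN aM]]; exists a; split; last exact: IHM aM.
  by move=> be /aN; apply: IHN.
- move=> [a [be [Hbe ->]]]; exists a, be; split => //; apply: IHM Hbe => y.
  by rewrite /update; case: eqP => _ ga //; apply: le.
Qed.

Lemma update_mono rho x Y Y' : Y `<=` Y' ->
  forall y, update rho x Y y `<=` update rho x Y' y.
Proof. by move=> le y; rewrite /update; case: eqP => _ ga //; apply: le. Qed.

(** Interpretation is continuous in each variable: a derivation of membership
    consults only finitely many elements of the environment. *)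
Lemma interp_compact M rho x alpha : interp M rho alpha ->
  exists a : {fset G}, [set` a] `<=` rho x /\
    interp M (update rho x [set` a]) alpha.
Proof.
elim: M rho alpha => [y|M IHM N IHN|y M IHM] rho alpha /=.
- case: (eqVneq y x) => [->|yx] Halpha.
    exists [fset alpha]%fset; split; first by move=> be /=; rewrite inE => /eqP ->.
    by rewrite update_same /= inE.
  by exists fset0; split=> //; rewrite update_other.
- move=> [b [bN bM]]; have [a [ax aM]] := IHM _ _ bM.
  (* Each of the finitely many elements of b has its own finite set. *)
  have [a' [a'x a'N]] : exists a', [set` a'] `<=` rho x /\
      forall be, be \in enum_fset b -> interp N (update rho x [set` a']) be.
    have {}bN : forall be, be \in enum_fset b -> interp N rho be by exact: bN.
    elim: (enum_fset b) bN => [|be s IHs] bN; first by exists fset0.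
    have [a1 [a1x a1N]] := IHN _ _ (bN _ (mem_head _ _)).
    have [|a2 [a2x a2N]] := IHs; first by move=> ga gs; apply: bN; rewrite inE gs orbT.
    exists (a1 `|` a2)%fset; split.
      by move=> ga /=; rewrite inE => /orP[/a1x|/a2x].
    move=> ga; rewrite inE => /orP[/eqP ->|/a2N].
      by move: a1N; apply/interp_mono/update_mono => de /= Hde; rewrite inE Hde.
    by apply/interp_mono/update_mono => de /= Hde; rewrite inE Hde orbT.
  exists (a `|` a')%fset; split.
    by move=> ga /=; rewrite inE => /orP[/ax|/a'x].
  exists b; split.
    move=> be /a'N; apply/interp_mono/update_mono => de /= Hde.
    by rewrite inE Hde orbT.
  by move: aM; apply/interp_mono/update_mono => de /= Hde; rewrite inE Hde.
- move=> [b [be [Hbe ->]]].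
  case: (eqVneq x y) => [->|xy].
    by exists fset0; split=> //; exists b, be; rewrite update_update.
  have [a [ax aM]] := IHM _ _ Hbe; rewrite update_other // in ax.
  by exists a; split=> //; exists b, be; rewrite update_swap.
Qed.

(** Validity of beta-conversion.  One inclusion is injectivity of the coding of
    pairs, the other is continuity. *)
Lemma apply_set_lam x M rho Y :
  apply_set (interp (Lam x M) rho) Y = interp M (update rho x Y).
Proof.
apply/seteqP; split=> alpha.
  move=> [a [aY /= [b [be [Hbe /tp_inj[eq_ab ->]]]]]]; rewrite {a}eq_ab in aY.
  by move: Hbe; apply/interp_mono/update_mono.
move=> /(@interp_compact _ _ x)[a]; rewrite update_same update_update.
by move=> [aY aM]; exists a; split=> //; exists a, alpha.
Qed.

Fixpoint free_vars M : seq nat :=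
  match M with
  | Var x => [:: x]
  | App M N => free_vars M ++ free_vars N
  | Lam x M => [seq y <- free_vars M | y != x]
  end.

Lemma interp_free_vars M rho rho' : {in free_vars M, rho =1 rho'} ->
  interp M rho = interp M rho'.
Proof.
elim: M rho rho' => [x|M IHM N IHN|x M IHM] rho rho' /= eq_rho.
- by apply: eq_rho; rewrite inE.
- rewrite (IHM rho rho'); last by move=> x xM; apply: eq_rho; rewrite mem_cat xM.
  by rewrite (IHN rho rho') // => x xN; apply: eq_rho; rewrite mem_cat xN orbT.
- have E a : interp M (update rho x [set` a]) = interp M (update rho' x [set` a]).
    apply: IHM => y yM; rewrite /update; case: (eqVneq y x) => // yx.
    by apply: eq_rho; rewrite mem_filter yx.
  by apply/seteqP; split=> ga [a [be [H ->]]]; exists a, be; rewrite ?E // -?E.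
Qed.

End GraphModel.

(** * Krivine's machine *)

(** Environments are total functions, so [Stuck] is what makes the type
    inhabited; it serves as the value of the variables that do not occur. *)
Inductive closure : Type :=
  | Stuck
  | Clo of term & (nat -> closure).

(** The closure under evaluation, and the stack of its arguments. *)
Definition state : Type := (closure * seq closure)%type.

Definition step (s : state) : option state :=
  match s with
  | (Clo (Var x) e, p) => Some (e x, p)
  | (Clo (App M N) e, p) => Some (Clo M e, Clo N e :: p)
  | (Clo (Lam x M) e, c :: p) => Some (Clo M (update e x c), p)
  | _ => None
  end.

Definition run n (s : state) : option state := iter n (obind step) (Some s).

Definition steps (s s' : state) : Prop := exists n, run n s = Some s'.

Lemma run_add m n s s' : run n s = Some s' -> run (m + n) s = run m s'.
Proof. by rewrite /run iterD => ->. Qed.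

Lemma steps_refl s : steps s s.
Proof. by exists 0. Qed.

Lemma steps_trans s2 s1 s3 : steps s1 s2 -> steps s2 s3 -> steps s1 s3.
Proof. by move=> [n /run_add En] [m Em]; exists (m + n); rewrite En. Qed.

Lemma step_steps s1 s2 s3 : step s1 = Some s2 -> steps s2 s3 -> steps s1 s3.
Proof. by move=> E; apply: steps_trans; exists 1. Qed.

(** A weak head normal form is an abstraction that meets an empty stack. *)
Definition halts (s : state) : Prop := exists x M e, steps s (Clo (Lam x M) e, [::]).

Lemma halts_steps s s' : steps s s' -> halts s' -> halts s.
Proof.
by move=> ss' [x [M [e H]]]; exists x, M, e; apply: steps_trans H.
Qed.

(** The machine is deterministic, so a halting run passes through every state
    that is reachable from its start. *)
Lemma steps_halts s s' : steps s s' -> halts s -> halts s'.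
Proof.
move=> [m]; elim: m s => [|m IHm] s; first by move=> [->].
rewrite /run iterSr /=; case E: (step s) => [s1|]; last first.
  by rewrite (_ : iter _ _ None = None) //; elim: m {IHm} => //= k ->.
move=> /IHm H [x [M [e [n En]]]]; apply: H; exists x, M, e.
case: n En => [[Es]|n]; first by rewrite Es in E.
by rewrite /run iterSr /= E; exists n.
Qed.

Lemma halts_not_forever s : halts s ->
  ~ (forall n, exists2 m, n <= m & exists s', run m s = Some s').
Proof.
move=> [x [M [e [n En]]]] /(_ n.+1)[m lenm [s']].
have -> : m = (m - n.+1).+1 + n by rewrite addSnnS subnK.
rewrite (run_add _ En) /run iterSr /=.
by rewrite (_ : iter _ _ None = None) //; elim: (m - n.+1) => //= k ->.
Qed.

(** An invariant that can be re-established after at least one transition gives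
    arbitrarily long runs. *)
Lemma progress_not_halts (P : nat -> state -> Prop) :
  (forall n s, P n s -> exists s1 s', [/\ step s = Some s1, steps s1 s' & P n.+1 s']) ->
  forall s, P 0 s -> ~ halts s.
Proof.
move=> HP s Ps /halts_not_forever; apply=> n.
suff [m [s' [lenm Em _]]] : exists m s', [/\ n <= m, run m s = Some s' & P n s'].
  by exists m => //; exists s'.
elim: n => [|n [m [s' [lenm Em Ps']]]]; first by exists 0, s.
have [s1 [s2 [E [k Ek] Ps2]]] := HP _ _ Ps'.
exists (k + 1 + m), s2; split=> //; first by rewrite addn1 addSn ltnS (leq_trans lenm) ?leq_addl.
by rewrite (run_add _ Em) (@run_add k 1 _ s1).
Qed.

Section Soundness.
Variable G : total_pair.

Fixpoint closure_interp (c : closure) : set G :=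
  if c is Clo M e then interp M (fun x => closure_interp (e x)) else set0.

Definition state_interp (s : state) : set G :=
  foldl (@apply_set G) (closure_interp s.1) (map closure_interp s.2).

Lemma step_interp s s' : step s = Some s' -> state_interp s = state_interp s'.
Proof.
case: s => [[//|[x|M N|x M] e]] [|c p] //= [<-] //.
rewrite /state_interp /= -[LHS]/(foldl _ (apply_set (interp (Lam x M) _) _) _).
rewrite apply_set_lam; congr (foldl _ (interp M _) _).
exact/esym/(update_map closure_interp).
Qed.

Lemma steps_interp s s' : steps s s' -> state_interp s = state_interp s'.
Proof.
move=> [n]; elim: n s' => [|n IHn] s' => [[->]//|].
rewrite /run /=; case E: (iter _ _ _) => [s''|//] /= /step_interp <-.
exact: IHn.
Qed.

End Soundness.

(** * Realizability *)

Section Adequacy.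
Variable A : partial_pair.

(** [tests u] is the set of stacks against which a closure of type u must halt;
    [realizes] is the orthogonal.  The type a -> alpha is tested by a realizer
    of a followed by a test of alpha, and also by the empty stack: this
    last test is what forces realizers of arrow types to be weakly head
    normalising.  An atom has no tests, so every closure realizes it.  The
    inner fixpoint spells out quantification over a list to stay structural. *)
Fixpoint tests (u : universe A) (p : seq closure) : Prop :=
  match u, p with
  | GenTree.Node _ (alpha :: a), c :: p' =>
      tests alpha p' /\
      (fix realizes_all (bs : seq (universe A)) : Prop :=
         if bs is beta :: bs'
         then (forall q, tests beta q -> halts (c, q)) /\ realizes_all bs'
         else True) a
  | GenTree.Node _ (_ :: _), [::] => True
  | _, _ => False
  end.

Definition realizes (c : closure) (u : universe A) : Prop :=
  forall p, tests u p -> halts (c, p).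

Lemma realizes_steps c c' u :
  (forall p, steps (c, p) (c', p)) -> realizes c' u -> realizes c u.
Proof. by move=> cc' c'u p /c'u; apply: halts_steps. Qed.

Lemma tests_opair a alpha c p : tests (opair a alpha) (c :: p) <->
  tests alpha p /\ forall beta, beta \in a -> realizes c beta.
Proof.
rewrite /opair /=.
set r := (X in _ /\ X _ <-> _).
have rE bs : r bs <-> forall beta, beta \in bs -> realizes c beta.
  elim: bs => [|be bs IH] /=; first by split.
  split=> [[H /IH Hbs] ga|H].
    by rewrite inE => /orP[/eqP -> //|]; apply: Hbs.
  split; first exact: (H be (mem_head _ _)).
  by apply/IH => ga gbs; apply: H; rewrite inE gbs orbT.
by split=> -[? /rE].
Qed.

(** If the pair (a, alpha) is in the domain of the partial injection then its
    value is an atom and there is nothing to prove. *)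
Lemma realizes_op (a : {fset universe A}) alpha M e x :
  (forall c, (forall beta, beta \in a -> realizes c beta) ->
     realizes (Clo M (update e x c)) alpha) ->
  realizes (Clo (Lam x M) e) (completion_op a alpha).
Proof.
move=> H; rewrite /completion_op; case: xgetP => [u _ [b [be [y [_ _ _ ->]]]]|_] //.
case=> [_|d p /tests_opair[tp Hd]]; first by exists x, M, e; apply: steps_refl.
apply: halts_steps (H d Hd p tp).
exact: step_steps (steps_refl _).
Qed.

(** If the pair (a, alpha) is in the domain of the partial injection then alpha
    is an atom, and nothing has to be known about M. *)
Lemma realizes_app (a : {fset universe A}) alpha M N e :
  realizes (Clo M e) (completion_op a alpha) ->
  (forall beta, beta \in a -> realizes (Clo N e) beta) ->
  realizes (Clo (App M N) e) alpha.
Proof.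
move=> + HN p tp; rewrite /completion_op.
case: xgetP => [u _ [b [be [y [_ _ E _]]]]|_] HM; first by rewrite E in tp.
apply: (halts_steps (s' := (Clo M e, Clo N e :: p))).
  exact: step_steps (steps_refl _).
by apply: HM; apply/tests_opair.
Qed.

Variables (G : total_pair) (f : G -> free_completion A).
Hypothesis f_morph : forall (a : {fset G}) (alpha : G),
  f (tp_fun (a, alpha)) = tp_fun ((f @` a)%fset, f alpha).

Definition tree (alpha : G) : universe A := val (f alpha).

Lemma tree_op a alpha :
  tree (tp_fun (a, alpha)) = completion_op (tree @` a)%fset (tree alpha).
Proof.
rewrite /tree f_morph /=; congr completion_op.
apply/fsetP => u; apply/imfsetP/imfsetP => /= [[be /imfsetP[ga /= ga_a ->] ->]|].
  by exists ga.
by move=> [ga ga_a ->]; exists (f ga) => //; apply/imfsetP; exists ga.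
Qed.

(** The fundamental lemma of the realizability interpretation: membership in the
    interpretation of a term is a typing judgement. *)
Lemma adequacy M rho e alpha :
  (forall x beta, rho x beta -> realizes (e x) (tree beta)) ->
  interp M rho alpha -> realizes (Clo M e) (tree alpha).
Proof.
elim: M rho e alpha => [x|M IHM N IHN|x M IHM] rho e alpha rho_e /=.
- move=> /rho_e; apply: realizes_steps => p; exact: step_steps (steps_refl _).
- move=> [a [aN aM]]; have := IHM _ _ _ rho_e aM; rewrite tree_op.
  move/realizes_app; apply=> u /imfsetP[be /= /aN H ->].
  exact: IHN rho_e H.
- move=> [a [be [Hbe ->]]]; rewrite tree_op; apply: realizes_op => c Hc.
  apply: IHM Hbe => y ga; rewrite /update; case: eqP => _; last exact: rho_e.
  by move=> ga_a; apply: Hc; apply/imfsetP; exists ga.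
Qed.

Lemma interp_not_atom_halts M alpha : interp M (fun=> set0) alpha ->
  ~ range (@atom A) (tree alpha) -> halts (Clo M (fun=> Stuck), [::]).
Proof.
move=> Malpha not_atom.
suff [a [be E]] : exists a be, tree alpha = opair a be.
  have /(_ [::]) : realizes (Clo M (fun=> Stuck)) (tree alpha).
    by apply: adequacy Malpha.
  by rewrite E; apply.
have [n _] := set_mem (valP (f alpha)).
case: n => [/not_atom//|n [/not_atom//|[a [be [_ _ _ E]]]]].
by exists a, be.
Qed.

End Adequacy.

(** * Programming the machine with numerals *)

(** A closure denotes n if it behaves, in front of two arguments, like the Scott
    numeral of n: it selects the first one for zero, and otherwise applies the
    second one to a closure for the predecessor.  The definition is about
    behaviour, hence covers unevaluated arguments. *)
Fixpoint denotes (n : nat) (c : closure) : Prop :=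
  match n with
  | 0 => forall z s p, steps (c, z :: s :: p) (z, p)
  | n'.+1 => forall z s p, exists c',
      denotes n' c' /\ steps (c, z :: s :: p) (s, c' :: p)
  end.

(** The closure reached may depend on the stack, since the behaviour of a
    numeral is only specified relative to its arguments. *)
Lemma denotes_stepwise n c :
  (forall p, exists c', denotes n c' /\ steps (c, p) (c', p)) -> denotes n c.
Proof.
move=> H; case: n H => [|n] H z s p; have [c' [Hc' sc']] := H (z :: s :: p).
  exact: steps_trans sc' (Hc' z s p).
by have [d [Hd sd]] := Hc' z s p; exists d; split=> //; apply: steps_trans sd.
Qed.

Lemma denotes_steps n c c' :
  (forall p, steps (c, p) (c', p)) -> denotes n c' -> denotes n c.
Proof. by move=> cc' Hc'; apply: denotes_stepwise => p; exists c'. Qed.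

Lemma denotes_var n x e : denotes n (e x) -> denotes n (Clo (Var x) e).
Proof. by apply: denotes_steps => p; exists 1. Qed.

Fixpoint numeral (n : nat) : term :=
  if n is n'.+1 then Lam 0 (Lam 1 (App (Var 1) (numeral n')))
  else Lam 0 (Lam 1 (Var 0)).

Lemma denotes_numeral n e : denotes n (Clo (numeral n) e).
Proof.
elim: n e => [|n IHn] e z s p; first by exists 3.
by exists (Clo (numeral n) (update (update e 0 z) 1 s)); split; [exact: IHn|exists 4].
Qed.

Definition succ_term : term := Lam 0 (Lam 1 (Lam 2 (App (Var 2) (Var 0)))).

Lemma denotes_succ n t e :
  denotes n (Clo t e) -> denotes n.+1 (Clo (App succ_term t) e).
Proof.
move=> Ht z s p; exists (Clo (Var 0) (update (update (update e 0 (Clo t e)) 1 z) 2 s)).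
by split; [apply: denotes_var|exists 6].
Qed.

Definition env_denotes (e : nat -> closure) (v : seq nat) : Prop :=
  forall i, i < size v -> denotes (nth 0 v i) (e i).

(** The term t may use further variables, whose values are unconstrained: only
    the variables below n are inputs. *)
Definition definable n (F : seq nat -> nat) : Prop :=
  exists t, forall e v, size v = n -> env_denotes e v -> denotes (F v) (Clo t e).

Lemma definable_ext n F F' : (forall v, size v = n -> F v = F' v) ->
  definable n F -> definable n F'.
Proof. by move=> E [t Ht]; exists t => e v sv ev; rewrite -E //; apply: Ht. Qed.

Lemma definable_proj n i : i < n -> definable n (fun v => nth 0 v i).
Proof.
by move=> lt_in; exists (Var i) => e v sv ev; apply/denotes_var/ev; rewrite sv.
Qed.

Lemma definable_const n k : definable n (fun=> k).
Proof. by exists (numeral k) => e v _ _; apply: denotes_numeral. Qed.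

Lemma definable_succ n F : definable n F -> definable n (fun v => (F v).+1).
Proof.
move=> [t Ht]; exists (App succ_term t) => e v sv ev; exact/denotes_succ/Ht.
Qed.

Lemma env_denotes_rcons e v x c k : size v = x ->
  env_denotes e v -> denotes k c -> env_denotes (update e x c) (rcons v k).
Proof.
move=> sv ev ck i; rewrite size_rcons ltnS nth_rcons sv leq_eqVlt /update.
case: (eqVneq i x) => [-> _|ni /= lti]; first by rewrite ltnn.
by rewrite lti; apply: ev; rewrite sv.
Qed.

(** The predecessor becomes the value of variable n, the first one that is not
    an input of the other branch. *)
Lemma definable_case n F H0 H1 :
  definable n F -> definable n H0 -> definable n.+1 H1 ->
  definable n (fun v => if F v is k.+1 then H1 (rcons v k) else H0 v).
Proof.
move=> [t Ht] [t0 Ht0] [t1 Ht1].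
exists (App (App t t0) (Lam n t1)) => e v sv ev.
have := Ht e v sv ev; case: (F v) => [|k] Hk.
  apply: denotes_steps (Ht0 e v sv ev) => p.
  by apply: steps_trans (Hk _ (Clo (Lam n t1) e) _); exists 2.
have Hstep p : exists c, denotes k c /\
    steps (Clo (App (App t t0) (Lam n t1)) e, p) (Clo t1 (update e n c), p).
  have [c [Hc sc]] := Hk (Clo t0 e) (Clo (Lam n t1) e) p.
  exists c; split=> //; apply: (@steps_trans (Clo t e, Clo t0 e :: Clo (Lam n t1) e :: p)).
    by exists 2.
  by apply: steps_trans sc _; exists 1.
have H1c c : denotes k c -> denotes (H1 (rcons v k)) (Clo t1 (update e n c)).
  by move=> Hc; apply: Ht1; rewrite ?size_rcons ?sv //; apply: env_denotes_rcons.
apply: denotes_stepwise => p; have [c [/H1c Hc sc]] := Hstep p.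
by exists (Clo t1 (update e n c)).
Qed.

(** Simultaneous binding of the variables below [size ts], with the definientia
    evaluated in the outer environment. *)
Definition lets (t : term) (ts : seq term) : term :=
  foldl App (foldr Lam t (iota 0 (size ts))) ts.

Lemma steps_apps u ts e p :
  steps (Clo (foldl App u ts) e, p) (Clo u e, [seq Clo t e | t <- ts] ++ p).
Proof.
elim: ts u p => [|t ts IHts] u p /=; first exact: steps_refl.
by apply: steps_trans (IHts _ _) _; exists 1.
Qed.

Lemma steps_lams t k cs e : exists e',
  [/\ forall p, steps (Clo (foldr Lam t (iota k (size cs))) e, cs ++ p) (Clo t e', p),
      forall i, i < size cs -> e' (k + i) = nth Stuck cs i
    & forall j, j < k -> e' j = e j].
Proof.
elim: cs k e => [|c cs IHcs] k e /=.
  by exists e; split=> // p; exact: steps_refl.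
have [e' [se' e'cs e'k]] := IHcs k.+1 (update e k c).
exists e'; split=> [p|[|i] lti|j ltj].
- exact: step_steps (se' p).
- by rewrite addn0 e'k // update_same.
- by rewrite addnS -addSn e'cs.
- by rewrite e'k ?ltnS 1?ltnW // update_other // ltn_eqF.
Qed.

Lemma steps_lets t ts e : exists e',
  (forall p, steps (Clo (lets t ts) e, p) (Clo t e', p)) /\
  forall i, i < size ts -> e' i = Clo (nth (Var 0) ts i) e.
Proof.
have [e' [se' e'ts _]] := steps_lams t 0 [seq Clo u e | u <- ts] e.
rewrite size_map in se' e'ts; exists e'; split=> [p|i lti].
  exact: steps_trans (steps_apps _ _ _ _) (se' p).
by rewrite -[i]add0n e'ts // (nth_map (Var 0)).
Qed.

Definition all_definable n (gs : seq (seq nat -> nat)) : Prop :=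
  foldr and True [seq definable n g | g <- gs].

Lemma definable_comp n m F gs : size gs = m -> definable m F ->
  all_definable n gs -> definable n (fun v => F [seq g v | g <- gs]).
Proof.
move=> <- [t Ht] Hgs.
have [ts [sts Hts]] : exists ts, size ts = size gs /\ forall e v, size v = n ->
    env_denotes e v -> forall i, i < size gs ->
    denotes (nth 0 [seq g v | g <- gs] i) (Clo (nth (Var 0) ts i) e).
  elim: gs {Ht} Hgs => [|g gs IHgs] /=; first by exists [::].
  move=> [[u Hu] /IHgs[us [sus Hus]]]; exists (u :: us); rewrite /= sus.
  split=> // e v sv ev [|i] /=; first by move=> _; apply: Hu.
  exact: Hus.
exists (lets t ts) => e v sv ev; have [e' [se' e'ts]] := steps_lets t ts e.
apply: denotes_steps se' _; apply: Ht; first by rewrite size_map.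
by move=> i; rewrite size_map => lti; rewrite e'ts ?sts //; apply: Hts.
Qed.

Lemma all_definable_map (I : Type) n (h : I -> seq nat -> nat) (s : seq I) :
  (forall i, definable n (h i)) -> all_definable n (map h s).
Proof. by move=> H; elim: s => //= i s IHs; split. Qed.

Lemma definable_rename n m F js : size js = m -> all (fun j => j < n) js ->
  definable m F -> definable n (fun v => F [seq nth 0 v j | j <- js]).
Proof.
move=> sjs Hjs HF.
have := @definable_comp n m F [seq (fun v => nth 0 v j) | j <- js].
rewrite size_map; move=> /(_ sjs HF) H.
have {H} : definable n (fun v => F [seq g v | g <- [seq (fun v => nth 0 v j) | j <- js]]).
  apply: H; elim: {sjs} js Hjs => //= j js IHjs /andP[ltj /IHjs]; split=> //.
  exact: definable_proj.
by apply: definable_ext => v _; rewrite -map_comp.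
Qed.

(** Recursion by self-application.  The counter is variable n and is shadowed by
    its predecessor, the recursive value is variable n+1, and n+2 holds
    the recursive program itself. *)
Lemma definable_rec n F0 F1 : definable n F0 -> definable n.+2 F1 ->
  definable n.+1 (fun v => nat_rect (fun=> nat) (F0 (take n v))
    (fun i y => F1 (rcons (rcons (take n v) i) y)) (nth 0 v n)).
Proof.
move=> [t0 Ht0] [t1 Ht1].
pose u := App (App (Var n.+2) (Var n.+2)) (Var n).
pose body := App (App (Var n) t0) (Lam n (App (Lam n.+1 t1) u)).
pose P := Lam n.+2 (Lam n body).
exists (App (App P P) (Var n)) => e v' sv' ev'.
set v := take n v'; set R := nat_rect _ _ _.
have sv : size v = n by rewrite size_takel // sv'.
have ev : env_denotes e v.
  by move=> i; rewrite sv => lti; rewrite nth_take //; apply: ev'; rewrite sv' ltnS ltnW.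
(* In a recursive call the program is bound to a closure that only evaluates to
   the original one, whence the generalisation over cr. *)
suff HR k : forall cr ck c, (forall p, steps (cr, p) (Clo P e, p)) -> denotes k ck ->
    (forall p, steps (c, p) (Clo P e, cr :: ck :: p)) -> denotes (R k) c.
  apply: (HR _ (Clo P e) (Clo (Var n) e)) => [p||p].
  - exact: steps_refl.
  - by apply/denotes_var/ev'; rewrite sv'.
  - by exists 2.
have neq1 : n.+2 != n by rewrite gtn_eqF // leqW.
have ev_update x c e' : n <= x -> env_denotes e' v -> env_denotes (update e' x c) v.
  move=> lex ev1 i; rewrite sv => lti.
  rewrite update_other; last by rewrite ltn_eqF // (leq_trans lti).
  by apply: ev1; rewrite sv.
elim: k => [|k IHk] cr ck c Hcr Hck Hc; set e2 := update (update e n.+2 cr) n ck.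
  have H0 : denotes (F0 v) (Clo t0 e2).
    by apply: Ht0 => //; apply/ev_update/ev_update; rewrite ?leqW.
  apply: denotes_steps H0 => p.
  apply: steps_trans (Hc p) _.
  apply: (@steps_trans (ck, Clo t0 e2 :: Clo (Lam n (App (Lam n.+1 t1) u)) e2 :: p)).
    by exists 5; rewrite /run /= /e2 update_same.
  exact: Hck.
pose e3 d := update e2 n d.
pose e4 d := update (e3 d) n.+1 (Clo u (e3 d)).
have Hstep p : exists d, denotes k d /\ steps (c, p) (Clo t1 (e4 d), p).
  have [d [Hd sd]] := Hck (Clo t0 e2) (Clo (Lam n (App (Lam n.+1 t1) u)) e2) p.
  exists d; split=> //; apply: steps_trans (Hc p) _.
  apply: (@steps_trans (ck, Clo t0 e2 :: Clo (Lam n (App (Lam n.+1 t1) u)) e2 :: p)).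
    by exists 5; rewrite /run /= /e2 update_same.
  by apply: steps_trans sd _; exists 3.
have H1 d : denotes k d -> denotes (R k.+1) (Clo t1 (e4 d)).
  move=> Hd; rewrite /R /= -/R; apply: Ht1; first by rewrite !size_rcons sv.
  apply: env_denotes_rcons; first by rewrite size_rcons sv.
    apply: env_denotes_rcons => //.
    by apply/ev_update/ev_update; rewrite ?leqW.
  apply: (IHk (Clo (Var n.+2) (e3 d)) (Clo (Var n) (e3 d))) => [p||p].
  - apply: step_steps (Hcr p); rewrite /= /e3 /e2 !(update_other _ _ neq1).
    by rewrite update_same.
  - by apply: denotes_var; rewrite /e3 update_same.
  - apply: (@steps_trans (cr, Clo (Var n.+2) (e3 d) :: Clo (Var n) (e3 d) :: p)); last exact: Hcr.
    by exists 3; rewrite /run /= /e3 /e2 !(update_other _ _ neq1) update_same.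
apply: denotes_stepwise => p; have [d [/H1 Hd sd]] := Hstep p.
by exists (Clo t1 (e4 d)).
Qed.

(** * Bounded evaluation of partial recursive functions *)

(** Approximation of the partial function denoted by f, in which s bounds all
    minimisations; 0 means undefined and y.+1 means the value y.  The state of
    a minimisation is 1 while the search goes on, y.+2 once it has
    found y, and 0 if it met an undefined value. *)
Fixpoint eval_within n (f : recfun n) (s : nat) (v : seq nat) : nat :=
  match f with
  | Rzero _ => 1
  | Rsucc => (nth 0 v 0).+2
  | Rproj _ i => (nth 0 v i).+1
  | Rcomp m _ f g =>
      let w := [seq eval_within (g i) s v | i <- enum 'I_m] in
      if 0 \in w then 0 else eval_within f s (map predn w)
  | Rprim _ f g =>
      nat_rect (fun=> nat) (eval_within f s (behead v))
        (fun i y => if y is z.+1 then eval_within g s (i :: z :: behead v) else 0)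
        (nth 0 v 0)
  | Rmin _ f =>
      (nat_rect (fun=> nat) 1
        (fun i y => if y is 1 then
           match eval_within f s (i :: v) with 0 => 0 | 1 => i.+2 | _ => 1 end else y)
        s).-1
  end.

(** For minimisation, the invariant of the search certifies both that the value
    is a zero and that all smaller arguments have positive values. *)
Lemma eval_within_computes n (f : recfun n) s (v : n.-tuple nat) y :
  eval_within f s v = y.+1 -> computes f v y.
Proof.
elim: f s v y => {n} [n||n i|m n f IHf g IHg|n f IHf g IHg|n f IHf] s v y /=.
- by case.
- by case=> <-; rewrite /thead (tnth_nth 0).
- by case=> <-; rewrite (tnth_nth 0).
- case: ifP => // /negbT w0 Hy.
  exists [tuple (eval_within (g i) s v).-1 | i < m]; split=> [i|].
    rewrite tnth_mktuple; apply: (IHg i s); rewrite prednK // lt0n.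
    by apply: contraNneq w0 => <-; apply: map_f; rewrite mem_enum.
  by apply: (IHf s); rewrite /= -map_comp in Hy *.
- rewrite /thead (tnth_nth 0); elim: (nth 0 v 0) y => [|k IHk] y /=.
    exact: (IHf s (behead_tuple v)).
  case E: (nat_rect _ _ _ _) => [//|z] Hy; exists z; split; first exact: IHk.
  exact: (IHg s [tuple of k :: z :: behead_tuple v]).
- set st := nat_rect _ _ _; move=> Hy.
  have Hst k : (st k = 1 -> forall i, i < k -> exists z, computes f [tuple of i :: v] z.+1) /\
    (forall y, st k = y.+2 -> computes f [tuple of y :: v] 0 /\
      forall i, i < y -> exists z, computes f [tuple of i :: v] z.+1).
    elim: k => [//|k [IH1 IH2]]; rewrite /st /= -/st.
    case E: (st k) => [|[|z]] //; last by split=> // y' Ey; apply: IH2; rewrite E Ey.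
    case F: (eval_within f s (k :: v)) => [|[|z]] //; split=> //.
      by move=> y' [<-]; split; [apply: (IHf s [tuple of k :: v])|exact: IH1].
    move=> _ i; rewrite ltnS leq_eqVlt => /orP[/eqP ->|/IH1]; last exact.
    by exists z; apply: (IHf s [tuple of k :: v]).
  by apply: (Hst s).2; case: (st s) Hy => [//|[//|z]] /= ->.
Qed.

(** Asking for all bounds from some point on lets the bounds of subcomputations
    be combined by a maximum, without a monotonicity lemma. *)
Lemma computes_eval_within n (f : recfun n) (v : n.-tuple nat) y :
  computes f v y -> exists s0, forall s, s0 <= s -> eval_within f s v = y.+1.
Proof.
elim: f v y => {n} [n||n i|m n f IHf g IHg|n f IHf g IHg|n f IHf] v y /=.
- by move=> ->; exists 0.
- by move=> ->; exists 0 => s _; rewrite /thead (tnth_nth 0).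
- by move=> ->; exists 0 => s _; rewrite (tnth_nth 0).
- move=> [w [Hw /IHf[s0 Hs0]]].
  have [s1 Hs1] : exists s1, forall i s, s1 <= s -> eval_within (g i) s v = (tnth w i).+1.
    have /choice[h Hh] i := IHg i _ _ (Hw i).
    exists (\max_i h i) => i s les; apply: Hh; apply: leq_trans les.
    exact: leq_bigmax.
  exists (maxn s0 s1) => s; rewrite geq_max => /andP[le0 le1].
  rewrite (eq_map (g := fun i => (tnth w i).+1)); last by move=> i; apply: Hs1.
  case: ifP => [/mapP[//]|_]; rewrite -map_comp (eq_map (g := tnth w)) //.
  by rewrite map_tnth_enum; exact: Hs0.
- rewrite /thead (tnth_nth 0); elim: (nth 0 v 0) y => [|k IHk] y /=.
    exact: (IHf (behead_tuple v)).
  move=> [z [/IHk[s0 Hs0] /IHg[s1 Hs1]]]; exists (maxn s0 s1) => s.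
  by rewrite geq_max => /andP[/Hs0 -> /Hs1 <-].
- move=> [/IHf[s0 Hs0] Hlt].
  have [s1 Hs1] : exists s1, forall i s, i < y -> s1 <= s ->
      exists z, eval_within f s (i :: v) = z.+2.
    have /choice[h Hh] i : exists s1, forall s, i < y -> s1 <= s ->
        exists z, eval_within f s (i :: v) = z.+2.
      case: (ltnP i y) => [/Hlt[z /IHf[s1 Hs1]]|_]; last by exists 0.
      by exists s1 => s _ /Hs1 E; exists z.
    exists (\max_(i < y) h i) => i s lti les; apply: Hh => //.
    by apply: leq_trans les; apply: (leq_bigmax (Ordinal lti)).
  exists (maxn y.+1 (maxn s0 s1)) => s; rewrite !geq_max => /and3P[ley le0 le1].
  set st := nat_rect _ _ _.
  have st1 k : k <= y -> st k = 1.
    elim: k => [//|k IHk] lek; rewrite /st /= -/st IHk ?(ltnW lek) //.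
    by have [z ->] := Hs1 k s lek le1.
  have sty k : st (k + y.+1) = y.+2.
    elim: k => [|k IHk]; last by rewrite addSn /st /= -/st IHk.
    by rewrite /st /= -/st st1 // (Hs0 s le0).
  by rewrite -(subnK ley) sty.
Qed.

Lemma definable_pred n F : definable n F -> definable n (fun v => (F v).-1).
Proof.
move=> HF; have := definable_case HF (definable_const n 0) (definable_proj (ltnSn n)).
apply: definable_ext => v sv; case: (F v) => [//|k].
by rewrite nth_rcons sv ltnn eqxx.
Qed.

Lemma definable_weaken n F :
  definable n F -> definable n.+1 (fun v => F (take n v)).
Proof.
move=> /(definable_rename (n := n.+1) (size_iota 0 n))[|t Ht].
  by apply/allP => j; rewrite mem_iota => /andP[_ /leqW].
exists t => e v sv ev; have := Ht e v sv ev.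
by rewrite map_nth_iota0 // sv.
Qed.

Lemma definable_if n F H0 H1 :
  definable n F -> definable n H0 -> definable n H1 ->
  definable n (fun v => if F v is _.+1 then H1 v else H0 v).
Proof.
move=> HF HH0 /definable_weaken /(definable_case HF HH0).
apply: definable_ext => v sv; case: (F v) => // k.
by rewrite -cats1 take_size_cat.
Qed.

(** Strictness of composition: one undefined argument makes the result
    undefined. *)
Lemma definable_guard n gs H : all_definable n gs -> definable n H ->
  definable n (fun v => if 0 \in [seq g v | g <- gs] then 0 else H v).
Proof.
move=> + HH; elim: gs => [_|g gs IHgs] //= [Hg /IHgs Hgs].
apply: definable_ext (definable_if Hg (definable_const n 0) Hgs) => v _.
by rewrite inE; case: (g v).
Qed.

Lemma map_nth_cons x0 (x : nat) s v n : size v = n ->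
  [seq nth x0 (x :: v ++ s) j | j <- iota 1 n] = v.
Proof.
move=> sv; rewrite map_nth_iota /= ?drop0 ?take_size_cat //.
by rewrite subn1 size_cat sv leq_addr.
Qed.

(** The bound s is the first input.  In the cases of recursion and minimisation
    the loop counter has to be moved last, where [definable_rec] expects it. *)
Lemma definable_eval_within n (f : recfun n) :
  definable n.+1 (fun w => eval_within f (nth 0 w 0) (behead w)).
Proof.
elim: f => {n} [n||n i|m n f IHf g IHg|n f IHf g IHg|n f IHf] /=.
- exact: definable_const.
- do 2 apply: definable_succ; apply: definable_ext (definable_proj (isT : 1 < 2)).
  by move=> v _; rewrite nth_behead.
- apply: definable_succ; have lt_in : i.+1 < n.+1 by rewrite ltnS.
  by apply: definable_ext (definable_proj lt_in) => v _; rewrite nth_behead.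
- pose gs := [seq (fun w => eval_within (g i) (nth 0 w 0) (behead w)) | i <- enum 'I_m].
  pose gs1 := (fun w => nth 0 w 0) ::
    [seq (fun w => (eval_within (g i) (nth 0 w 0) (behead w)).-1) | i <- enum 'I_m].
  have Hgs : all_definable n.+1 gs by exact: all_definable_map.
  have Hgs1 : all_definable n.+1 gs1.
    split; first exact: definable_proj.
    by apply: all_definable_map => i; apply: definable_pred.
  have sgs1 : size gs1 = m.+1 by rewrite /= size_map size_enum_ord.
  apply: definable_ext (definable_guard Hgs (definable_comp sgs1 IHf Hgs1)) => w _.
  by rewrite /gs /gs1 /= -!map_comp.
- have step_def : definable n.+3 (fun q => if nth 0 q n.+2 is z.+1 then
      eval_within g (nth 0 (rcons q z) 0)
        (nth 0 (rcons q z) n.+1 :: nth 0 (rcons q z) n.+3 :: [seq nth 0 (rcons q z) j | j <- iota 1 n]) else 0).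
    have := @definable_rename n.+4 n.+3 _ (0 :: n.+1 :: n.+3 :: iota 1 n) _ _ IHg.
    move/(_ _ _)/(definable_case (definable_proj (ltnSn n.+2)) (definable_const _ 0)).
    apply; first by rewrite /= size_iota.
    rewrite /= !ltnS !leqnn leqW // ?leqW //=.
    by apply/allP => j; rewrite mem_iota => /andP[_]; lia.
  have := definable_rename (n := n.+2) (js := 0 :: rcons (iota 2 n) 1) _ _
    (definable_rec IHf step_def).
  move/(_ _ _); set F := (F in definable _ F); move=> HF.
  apply: (definable_ext (F := F)); last first.
    apply: HF; first by rewrite /= size_rcons size_iota.
    by rewrite /= all_rcons /=; apply/allP => j; rewrite mem_iota; lia.
  move=> [//|s [//|k v]] [sv]; rewrite /F /= map_rcons map_nth_iota /= ?sv ?subn2 //.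
  have tv : take n v = v by rewrite -sv take_size.
  have tvk : take n (rcons v k) = v by rewrite -cats1 take_size_cat.
  rewrite drop0 tv tvk nth_rcons sv ltnn eqxx.
  elim: k {tvk} => [//|k IHk]; rewrite [LHS]/= IHk [RHS]/=.
  set y := nat_rect _ _ _ _.
  have E i s' : nth 0 (v ++ s') (i + n) = nth 0 s' i.
    by rewrite nth_cat sv ltnNge leq_addl addnK.
  rewrite -!cats1 -!catA (E 1) /=; case: y => [//|z].
  by rewrite -cats1 -catA (E 0) (E 2) map_nth_cons.
- have Hev : definable n.+3 (fun q =>
      eval_within f (nth 0 q 0) (nth 0 q n.+1 :: [seq nth 0 q j | j <- iota 1 n])).
    have := @definable_rename n.+3 n.+2 _ (0 :: n.+1 :: iota 1 n) _ _ IHf.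
    apply; first by rewrite /= size_iota.
    rewrite /= ltnS leqW //=.
    by apply/allP => j; rewrite mem_iota => /andP[_]; lia.
  pose E q := eval_within f (nth 0 q 0) (nth 0 q n.+1 :: [seq nth 0 q j | j <- iota 1 n]).
  (* The transition of the search, with its nested case distinctions expressed
     by predecessors and tests for zero. *)
  pose st q := if nth 0 q n.+2 is _.+1 then
    if (nth 0 q n.+2).-1 is _.+1 then nth 0 q n.+2
    else if E q is _.+1 then
      if (E q).-1 is _.+1 then 1 else (nth 0 q n.+1).+2 else 0
    else 0.
  have st_def : definable n.+3 st.
    have proj2 : definable n.+3 (fun q => nth 0 q n.+2) by exact: definable_proj.
    apply: definable_if => //; first exact: definable_const.
    apply: definable_if => //; first exact: definable_pred.
    apply: definable_if => //; first exact: definable_const.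
    apply: definable_if; first exact: definable_pred.
      by do 2 apply: definable_succ; apply: definable_proj.
    exact: definable_const.
  have := definable_rename (n := n.+1) (js := rcons (iota 0 n.+1) 0) _ _
    (definable_rec (definable_const n.+1 1) st_def).
  move/(_ _ _)/definable_pred; set F := (F in definable _ F); move=> HF.
  apply: (definable_ext (F := F)); last first.
    apply: HF; first by rewrite size_rcons size_iota.
    by rewrite all_rcons; apply/allP => j; rewrite mem_iota.
  move=> [//|s v] [sv]; rewrite /F map_rcons map_nth_iota0 /= ?sv //.
  have tv : take n v = v by rewrite -sv take_size.
  have tvs : take n (rcons v s) = v by rewrite -cats1 take_size_cat.
  rewrite tv tvs nth_rcons sv ltnn eqxx; congr _.-1.
  have nthv i s' : nth 0 (v ++ s') (i + n) = nth 0 s' i.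
    by rewrite nth_cat sv ltnNge leq_addl addnK.
  elim: {2 4}s => [//|k IHk]; rewrite [LHS]/= IHk [RHS]/=.
  set y := nat_rect _ _ _ _.
  rewrite /st /E -!cats1 -catA /= (nthv 0) (nthv 1) /=.
  case: y => [//|[|y] //=].
  by rewrite map_nth_cons //; case: (eval_within f _ _) => [|[|z]].
Qed.

(** * Arithmetic and codes of terms *)

Lemma definable_comp1 n F g : definable 1 (fun v => F (nth 0 v 0)) ->
  definable n g -> definable n (fun v => F (g v)).
Proof.
move=> HF Hg; apply: definable_ext (definable_comp (gs := [:: g]) _ HF _) => //.
Qed.

Lemma definable_comp2 n F g h : definable 2 (fun v => F (nth 0 v 0) (nth 0 v 1)) ->
  definable n g -> definable n h -> definable n (fun v => F (g v) (h v)).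
Proof.
move=> HF Hg Hh; apply: definable_ext (definable_comp (gs := [:: g; h]) _ HF _) => //.
Qed.

Lemma definable_add n F H : definable n F -> definable n H ->
  definable n (fun v => F v + H v).
Proof.
apply: (definable_comp2 (F := addn)).
have last_succ : definable 3 (fun v => (nth 0 v 2).+1).
  exact/definable_succ/definable_proj.
apply: definable_ext (definable_rec (definable_proj (ltnSn 0)) last_succ).
move=> [|a [|b []]] //= _; elim: b => [|b /= ->]; first by rewrite addn0.
by rewrite addnS.
Qed.

Lemma definable_cantor n F H : definable n F -> definable n H ->
  definable n (fun v => cantor (F v) (H v)).
Proof.
move=> HF HH; apply: definable_add => //.
apply: (definable_comp1 (F := fun k => 'C(k.+1, 2))); last exact: definable_add.
have step_def : definable 2 (fun v => (nth 0 v 0).+1 + nth 0 v 1).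
  by apply: definable_add; [apply: definable_succ|]; apply: definable_proj.
apply: definable_ext (definable_rec (definable_const 0 0) step_def).
move=> [|k []] //= _; elim: k => [//|k /= ->].
by rewrite [in RHS]binS bin1 addnC.
Qed.

Lemma definable_mul3 n F : definable n F -> definable n (fun v => 3 * F v).
Proof.
move=> HF; apply: definable_ext (definable_add HF (definable_add HF HF)) => v _; lia.
Qed.

Lemma definable_code_app n F H : definable n F -> definable n H ->
  definable n (fun v => 3 * cantor (F v) (H v) + 1).
Proof.
move=> HF HH; apply: definable_add (definable_const _ _).
exact/definable_mul3/definable_cantor.
Qed.

Lemma definable_code_lam n F H : definable n F -> definable n H ->
  definable n (fun v => 3 * cantor (F v) (H v) + 2).
Proof.
move=> HF HH; apply: definable_add (definable_const _ _).
exact/definable_mul3/definable_cantor.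
Qed.

Lemma definable_code_numeral n F : definable n F ->
  definable n (fun v => code (numeral (F v))).
Proof.
apply: (definable_comp1 (F := fun k => code (numeral k))).
have step_def : definable 2 (fun v =>
    3 * cantor 0 (3 * cantor 1 (3 * cantor (3 * 1) (nth 0 v 1) + 1) + 2) + 2).
  do 2 apply: (definable_code_lam (definable_const _ _)).
  exact: definable_code_app (definable_const _ _) (definable_proj _).
apply: definable_ext (definable_rec (definable_const 0 (code (numeral 0))) step_def).
by move=> [|k []] // _; rewrite [take _ _]/= [nth _ _ _]/=; elim: k => [//|k /= ->].
Qed.

(** The pairs on one diagonal are numbered by an interval that ends before the
    interval of the next diagonal starts. *)
Lemma cantor_inj m n m' n' : cantor m n = cantor m' n' -> m = m' /\ n = n'.
Proof.
have lt_bin a b : a < b -> 'C(a.+1, 2) + a < 'C(b.+1, 2).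
  move=> ltab; apply: (@leq_trans 'C(a.+2, 2)); last exact: leq_bin2l.
  by rewrite [X in _ < X]binS bin1; lia.
rewrite /cantor => E.
have [lt|lt|eq] := ltngtP (m + n) (m' + n').
- by have := lt_bin _ _ lt; lia.
- by have := lt_bin _ _ lt; lia.
- by move: E; rewrite eq; lia.
Qed.

Lemma code_inj : injective code.
Proof.
elim=> [x|M IHM N IHN|x M IHM] [y|M' N'|y M'] /= E; try lia.
- by congr Var; lia.
- have [/IHM-> /IHN->] // : code M = code M' /\ code N = code N' by apply: cantor_inj; lia.
- have [-> /IHM->] // : x = y /\ code M = code M' by apply: cantor_inj; lia.
Qed.

Lemma code_pair_inj : injective code_pair.
Proof. by move=> [M N] [M' N'] /cantor_inj /= [/code_inj-> /code_inj->]. Qed.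

(** * Unbounded search and diagonalisation *)

Definition id_term : term := Lam 0 (Var 0).

(** A test t with inputs w and s, in variables 0 and 1, is tried for increasing
    s: on zero the loop, held in variable 2, calls itself on the successor of s,
    and otherwise the identity is returned. *)
Definition search_loop (t : term) : term :=
  Lam 2 (Lam 1 (App (App t (App (App (Var 2) (Var 2)) (App succ_term (Var 1))))
    (Lam 2 id_term))).

Definition search (t : term) : term :=
  App (App (search_loop t) (search_loop t)) (numeral 0).

Section Search.
Variables (t : term) (e : nat -> closure) (F : nat -> nat).
Hypothesis tF : forall e' k, e' 0 = e 0 -> denotes k (e' 1) ->
  denotes (F k) (Clo t e').

Definition search_state (k : nat) (s : state) : Prop := exists cr cs,
  [/\ forall p, steps (cr, p) (Clo (search_loop t) e, p), denotes k cs
    & s = (Clo (search_loop t) e, [:: cr; cs])].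

Lemma search_start : exists2 s, steps (Clo (search t) e, [::]) s & search_state 0 s.
Proof.
exists (Clo (search_loop t) e, [:: Clo (search_loop t) e; Clo (numeral 0) e]).
  by exists 2.
exists (Clo (search_loop t) e), (Clo (numeral 0) e).
by split=> // [p|]; [exact: steps_refl|exact: (denotes_numeral 0)].
Qed.

Lemma search_next k s : F k = 0 -> search_state k s ->
  exists s1 s', [/\ step s = Some s1, steps s1 s' & search_state k.+1 s'].
Proof.
move=> Fk [cr [cs [Hcr Hcs ->]]].
pose e1 := update (update e 2 cr) 1 cs.
pose next := Clo (App (App (Var 2) (Var 2)) (App succ_term (Var 1))) e1.
have := tF (e' := e1) (erefl _) Hcs; rewrite Fk => /(_ next (Clo (Lam 2 id_term) e1) [::]) te1.
eexists; exists (Clo (search_loop t) e, [:: Clo (Var 2) e1; Clo (App succ_term (Var 1)) e1]).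
split; first by [].
  apply: (@steps_trans (Clo t e1, [:: next; Clo (Lam 2 id_term) e1])); first by exists 3.
  apply: steps_trans te1 _; apply: steps_trans (Hcr _); by exists 3.
exists (Clo (Var 2) e1), (Clo (App succ_term (Var 1)) e1); split=> //.
  by move=> p; apply: step_steps (Hcr p).
exact/denotes_succ/denotes_var.
Qed.

Lemma search_not_halts : (forall k, F k = 0) -> ~ halts (Clo (search t) e, [::]).
Proof.
move=> F0 H.
have [s st s0] := search_start; apply: (progress_not_halts _ s0) (steps_halts st H).
by move=> k s'; apply: search_next.
Qed.

Lemma search_found k : F k != 0 ->
  exists e', steps (Clo (search t) e, [::]) (Clo id_term e', [::]).
Proof.
move=> Fk; have [k0 Fk0 mink0] := ex_minnP (ex_intro (fun k => F k != 0) k Fk).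
have [s [ss [cr [cs [Hcr Hcs Es]]]]] : exists s,
    steps (Clo (search t) e, [::]) s /\ search_state k0 s.
  have {Fk0} : forall i, i < k0 -> F i = 0.
    by move=> i lti; apply: contraTeq lti => /mink0; rewrite -leqNgt.
  elim: k0 {mink0} => [|i IHi] Hi.
    by have [s ? ?] := search_start; exists s.
  have [|s [ss Hs]] := IHi; first by move=> j ltj; apply: Hi; apply: ltnW.
  have [s1 [s' [E ss' Hs']]] := search_next (Hi i (ltnSn i)) Hs.
  exists s'; split=> //; apply: steps_trans ss _; exact: step_steps E ss'.
pose e1 := update (update e 2 cr) 1 cs.
pose next := Clo (App (App (Var 2) (Var 2)) (App succ_term (Var 1))) e1.
have := tF (e' := e1) (erefl _) Hcs; case: (F k0) Fk0 => [//|j] _.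
move=> /(_ next (Clo (Lam 2 id_term) e1) [::]) [c [_ te1]].
exists (update e1 2 c); apply: steps_trans ss _; rewrite Es.
apply: (@steps_trans (Clo t e1, [:: next; Clo (Lam 2 id_term) e1])); first by exists 4.
by apply: steps_trans te1 _; exists 1.
Qed.

End Search.

Lemma free_vars_numeral n : free_vars (numeral n) = [::].
Proof. by elim: n => //= n ->. Qed.

Lemma free_vars_apps u ts x : x \in free_vars (foldl App u ts) ->
  x \in free_vars u \/ exists2 s, s \in [seq free_vars t | t <- ts] & x \in s.
Proof.
elim: ts u => [|t ts IHts] u /=; first by left.
move=> /IHts[/=|[s sts xs]]; last by right; exists s; rewrite // inE sts orbT.
by rewrite mem_cat => /orP[|xt]; [left|right; exists (free_vars t); rewrite ?mem_head].
Qed.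

Lemma free_vars_lams xs t x :
  (x \in free_vars (foldr Lam t xs)) = (x \in free_vars t) && (x \notin xs).
Proof.
elim: xs => [|y xs IHxs] /=; first by rewrite andbT.
by rewrite mem_filter IHxs inE negb_or; case: (x == y); rewrite ?andbF.
Qed.

(** A program may contain variables that are not inputs; binding all of them to
    the numeral of zero gives a closed term with the same behaviour. *)
Lemma closed_abstraction t : exists2 W, free_vars W = [::] &
  forall e c p, exists2 e', e' 0 = Clo (Var 0) (update e 0 c) &
    steps (Clo W e, c :: p) (Clo t e', p).
Proof.
pose n := \max_(x <- free_vars t) x.
(* Variable 0 is rebound to itself. *)
exists (Lam 0 (lets t (Var 0 :: nseq n (numeral 0)))).
  apply/eqP; rewrite -[_ == _]negbK -has_filter; apply/hasPn => x.
  rewrite /lets [size _]/= size_nseq.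
  move=> /free_vars_apps [|[s]].
    rewrite free_vars_lams mem_iota /= add0n ltnS => /andP[xt].
    by have -> : x <= n by exact: (leq_bigmax_seq (F := id) x).
  rewrite map_cons map_nseq free_vars_numeral in_cons mem_nseq.
  by move=> /orP[/eqP ->|/andP[_ /eqP ->]//]; rewrite inE negbK.
move=> e c p; have [e' [se' He']] := steps_lets t (Var 0 :: nseq n (numeral 0)) (update e 0 c).
by exists e'; [apply: (He' 0)|apply: step_steps (se' p)].
Qed.

Lemma interp_id_infinite (G : total_pair) (rho : nat -> set G) :
  infinite_set (interp id_term rho).
Proof.
pose pair_self (alpha : G) := tp_fun ([fset alpha]%fset, alpha).
have pair_self_inj : injective pair_self by move=> alpha beta /tp_inj[].
move=> fin; apply: (@tp_infinite G).
have <- := eq_finite_set (inj_card_eq (A := [set: G]) (f := pair_self) (in2W pair_self_inj)).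
apply: sub_finite_set fin => _ [alpha _ <-].
exists [fset alpha]%fset, alpha; split=> //.
by rewrite /= update_same /= inE.
Qed.

(** A finite set has finitely many subsets, so the closed terms interpreted
    inside it fall into finitely many classes modulo equality in the model. *)
Lemma finite_representatives (G : total_pair) (F : set G) (rho : nat -> set G) :
  finite_set F -> exists k (Ms : 'I_k -> term),
    (forall i, interp (Ms i) rho `<=` F /\ free_vars (Ms i) = [::]) /\
    forall N, free_vars N = [::] -> interp N rho `<=` F ->
      exists i, interp (Ms i) rho = interp N rho.
Proof.
move=> finF.
pose good (a : {fset G}) := exists M, free_vars M = [::] /\ interp M rho = [set` a].
pose L := [seq a <- enum_fset (fpowerset (fset_set F)) | `[< good a >]].
have /choice[Ms HMs] (i : 'I_(size L)) : exists M, free_vars M = [::] /\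
    interp M rho = [set` nth fset0 L i].
  have := mem_nth fset0 (ltn_ord i).
  by rewrite mem_filter => /andP[/asboolP].
exists (size L), Ms; split=> [i|N cN NF].
  have [cM ->] := HMs i; split=> // alpha /= alpha_i.
  have := mem_nth fset0 (ltn_ord i).
  rewrite mem_filter => /andP[_ iF].
  have {}iF : (nth fset0 L i `<=` fset_set F)%fset by rewrite -fpowersetE.
  by have := fsubsetP iF _ alpha_i; rewrite in_fset_set // => /set_mem.
have finN := sub_finite_set NF finF.
have NL : fset_set (interp N rho) \in L.
  rewrite mem_filter; apply/andP; split.
    by apply/asboolP; exists N; rewrite fset_setK.
  suff : fset_set (interp N rho) \in fpowerset (fset_set F) by [].
  by rewrite fpowersetE; apply/fsubsetP => x; rewrite !in_fset_set // => /set_mem /NF /mem_set.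
have NLi := NL; rewrite -index_mem in NLi.
exists (Ordinal NLi); have [_ ->] := HMs (Ordinal NLi).
by rewrite /= nth_index // fset_setK.
Qed.

Lemma code_pair_Th (G : total_pair) M N (rho : nat -> set G) :
  free_vars M = [::] -> free_vars N = [::] ->
  [set code_pair p | p in Th G] (code_pair (M, N)) <-> interp M rho = interp N rho.
Proof.
move=> cM cN; split=> [[p pTh /code_pair_inj E]|E]; first by rewrite E in pTh; apply: pTh.
exists (M, N) => // rho' /=.
have H K : free_vars K = [::] -> interp K rho' = interp K rho.
  by move=> cK; apply: interp_free_vars; rewrite cK.
by rewrite !H.
Qed.

Lemma definable_has n gs : all_definable n gs ->
  definable n (fun v => has (fun x => x != 0) [seq g v | g <- gs]).
Proof.
elim: gs => [_|g gs IHgs] /=; first exact: definable_const.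
move=> [Hg /IHgs Hgs]; apply: definable_ext (definable_if Hg Hgs (definable_const n 1)).
by move=> v _; case: (g v).
Qed.

(** Q is W applied to the numeral of the code w of W.  The code of Q is a
    definable function of w, so W can compute from w the code of the term that
    it is going to be a part of, and then run f in parallel on the pairs
    formed by Q and each of the [Ms i]. *)
Lemma diagonal k (f : recfun 1) (Ms : 'I_k -> term) :
  exists Q, free_vars Q = [::] /\
    ((forall i y, ~ computes f [tuple code_pair (Q, Ms i)] y) ->
       ~ halts (Clo Q (fun=> Stuck), [::])) /\
    (forall i y, computes f [tuple code_pair (Q, Ms i)] y ->
       exists e, steps (Clo Q (fun=> Stuck), [::]) (Clo id_term e, [::])).
Proof.
pose self w := 3 * cantor w (code (numeral w)) + 1.
pose try (i : 'I_k) (v : seq nat) :=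
  eval_within f (nth 0 v 1) [:: cantor (self (nth 0 v 0)) (code (Ms i))].
have self_def : definable 2 (fun v => self (nth 0 v 0)).
  by apply: definable_code_app; [|apply: definable_code_numeral]; apply: definable_proj.
have try_def i : definable 2 (try i).
  pose query v := cantor (self (nth 0 v 0)) (code (Ms i)).
  have query_def : definable 2 query by apply: definable_cantor (definable_const _ _).
  apply: definable_ext
    (definable_comp (gs := [:: fun v => nth 0 v 1; query]) _ (definable_eval_within f) _) => //.
  by split; [apply: definable_proj|].
have [t Ht] := definable_has (all_definable_map (enum 'I_k) try_def).
have [W cW HW] := closed_abstraction (search t).
pose w := code W; pose Q := App W (numeral w).
have selfE : self w = code Q by [].
pose found s : nat := has (fun x => x != 0) [seq g [:: w; s] | g <- [seq try i | i <- enum 'I_k]].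
have [e' e'0 sQ] := HW (fun=> Stuck) (Clo (numeral w) (fun=> Stuck)) [::].
have {}sQ : steps (Clo Q (fun=> Stuck), [::]) (Clo (search t) e', [::]).
  exact: step_steps sQ.
have t_found e s : e 0 = e' 0 -> denotes s (e 1) -> denotes (found s) (Clo t e).
  move=> e0 es; apply: Ht => // -[|[|//]] _ //=.
  by rewrite e0 e'0; apply/denotes_var/denotes_numeral.
have foundP s : reflect (exists i, eval_within f s [:: code_pair (Q, Ms i)] != 0) (found s != 0).
  rewrite /found -map_comp eqb0 negbK; apply: (iffP hasP).
    by move=> [_ /mapP[i _ ->] ?]; exists i.
  move=> [i Hi]; exists (try i [:: w; s]) => //.
  by apply/mapP; exists i; rewrite ?mem_enum.
exists Q; split; first by rewrite /= cW free_vars_numeral.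
split=> [no_answer /(steps_halts sQ)|i y /computes_eval_within[s /(_ s (leqnn s)) Hs]].
  apply: (search_not_halts t_found) => s.
  apply/eqP; apply: contraT => /foundP[i].
  case E: (eval_within _ _ _) => [//|y] _.
  by case: (no_answer i y); apply: (eval_within_computes E).
have [|e se] := search_found t_found (k := s).
  by apply/foundP; exists i; rewrite Hs.
by exists e; apply: steps_trans se.
Qed.

Lemma finite_atoms (G : total_pair) (A : partial_pair) (f : G -> free_completion A) :
  injective f -> finite_partial_pair A ->
  finite_set [set alpha | range (@atom A) (tree f alpha)].
Proof.
move=> f_inj finA.
have tree_inj : injective (tree f) by move=> alpha beta /val_inj /f_inj.
set S := [set alpha | _].
have <- := eq_finite_set (inj_card_eq (A := S) (in2W tree_inj)).
apply: (sub_finite_set (B := range (@atom A))); last exact: finite_image.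
by move=> _ [alpha Halpha <-].
Qed.

Theorem theorem5 (G : total_pair) (A : partial_pair)
  (finA : finite_partial_pair A) (genGA : freely_generated G A) :
  ~ rec_enumerable_pairs (Th G).
Proof.
move=> [f Hf]; have [h [h_bij h_morph]] := genGA.
pose rho : nat -> set G := fun=> set0.
pose atoms : set G := [set alpha | range (@atom A) (tree h alpha)].
have fin_atoms : finite_set atoms := finite_atoms (bij_inj h_bij) finA.
have [k [Ms [HMs Ms_all]]] := finite_representatives rho fin_atoms.
have [Q [cQ [Q_diverges Q_id]]] := diagonal f Ms.
have no_answer i y : ~ computes f [tuple code_pair (Q, Ms i)] y.
  move=> Hy; have QMi : interp Q rho = interp (Ms i) rho.
    by apply/(code_pair_Th rho cQ (HMs i).2)/Hf; exists y.
  have [e /(steps_interp G)] := Q_id i y Hy.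
  rewrite /state_interp /= -/rho -[LHS]/(interp Q rho) => Qid.
  have := @interp_id_infinite G (fun x => closure_interp (e x)).
  rewrite -[X in infinite_set X]Qid QMi; apply.
  exact: sub_finite_set (HMs i).1 fin_atoms.
have Q_atoms : interp Q rho `<=` atoms.
  move=> alpha Qalpha; apply: contrapT => not_atom.
  apply: (Q_diverges no_answer).
  exact: (interp_not_atom_halts h_morph Qalpha not_atom).
have [i MiQ] := Ms_all Q cQ Q_atoms.
have /Hf[y Hy] := (code_pair_Th rho cQ (HMs i).2).2 (esym MiQ).
exact: no_answer Hy.
Qed.
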